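(* Let $n\ge 2$ be an integer and let $0<\alpha\le 1\le\beta$ be real numbers. Then for every $F\in\mathcal B(\alpha,\beta,n)$ and every measurable set $A\subset[0,1)$, $$\|S_\beta(\mathbbm 1_A)\|_\alpha\ge F(|A|).$$
   Context: $[0,1)$ carries Lebesgue measure and $|A|$ denotes the Lebesgue measure of $A$. For $m\ge0$, let $\mathcal I_m=\{[k/n^m,(k+1)/n^m):k=0,\dots,n^m-1\}$ be the $n$-adic intervals of level $m$ and $\mathcal N_m=\sigma(\mathcal I_m)$ the $\sigma$-algebra they generate. For $f\in L^1[0,1)$ put $f_m=\mathbb E(f\mid\mathcal N_m)=\sum_{I\in\mathcal I_m}\mathbbm 1_I\,\frac1{|I|}\int_I f(y)\,dy$ for $m\ge 0$, $d_m=f_m-f_{m-1}$ for $m\ge1$, and $$S_\beta(f)=\Big(\sum_{m=1}^\infty|d_m|^\beta\Big)^{1/\beta},$$ with the value $+\infty$ allowed. For measurable $g\ge 0$, $\|g\|_\alpha=\big(\int_0^1 g^\alpha\,dx\big)^{1/\alpha}$ (possibly $+\infty$). $\mathcal B(\alpha,\beta,n)$ is the family of all continuous functions $F:[0,1]\to[0,\infty)$ with $F(0)=F(1)=0$ such that for every $x_1,\dots,x_n\in[0,1]$, with $\bar x=\frac1n\sum_{i=1}^n x_i$, $$F(\bar x)^\alpha\le\frac1n\sum_{i=1}^n\big(F(x_i)^\beta+|x_i-\bar x|^\beta\big)^{\alpha/\beta}.$$ *)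

(* Defs.v *)
From HB Require Import structures.
From mathcomp Require Import all_boot all_order all_algebra.
From mathcomp Require Import all_classical all_reals all_analysis.

Set Implicit Arguments.
Unset Strict Implicit.
Unset Printing Implicit Defensive.

Import Order.TTheory GRing.Theory Num.Theory.
Import numFieldNormedType.Exports.

Local Open Scope classical_set_scope.
Local Open Scope ring_scope.

(* Lebesgue (not only Borel) measurability: the sigma-algebra on which
   [completed_lebesgue_measure] is a measure.  By the library's
   [completed_caratheodory_measurable] it is the completion of the Borel sets. *)
Definition lebesgue_measurable (R : realType) (A : set R) : Prop :=
  ((wlength (@idfun R))^*)%mu.-cara.-measurable A.

Definition adic_itv (R : realType) (n m k : nat) : set R :=
  `[k%:R / n%:R ^+ m, k.+1%:R / n%:R ^+ m[%classic.

(* [adic_mean n m f] is the conditional expectation E(f | N_m), where N_m is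
   generated by the finite partition of [0, 1[ into the [adic_itv n m k]. *)
Definition adic_mean (R : realType) (n m : nat) (f : R -> R) (x : R) : R :=
  \sum_(k < n ^ m)
     \1_(@adic_itv R n m k) x *
     ((fine (completed_lebesgue_measure (@adic_itv R n m k)))^-1 *
      \int[completed_lebesgue_measure]_(y in @adic_itv R n m k) f y).

(* Only meaningful for m >= 1. *)
Definition adic_diff (R : realType) (n m : nat) (f : R -> R) (x : R) : R :=
  adic_mean n m f x - adic_mean n m.-1 f x.

Definition S_fun (R : realType) (n : nat) (beta : R) (f : R -> R) (x : R)
    : \bar R :=
  ((\sum_(1 <= m <oo) (`|adic_diff n m f x| `^ beta)%:E) `^ beta^-1)%E.

(* For g >= 0. *)
Definition norm01 (R : realType) (alpha : R) (g : R -> \bar R) : \bar R :=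
  ((\int[completed_lebesgue_measure]_(x in `[0%R, 1%R[) (g x `^ alpha))
     `^ alpha^-1)%E.

(* Functions on [0, 1] are represented by functions on R; their values outside
   [0, 1] play no role. *)
Definition calB (R : realType) (alpha beta : R) (n : nat) : set (R -> R) :=
  [set F : R -> R | [/\ {within `[0, 1], continuous F},
               (forall x : R, x \in `[0, 1] -> 0 <= F x),
               F 0 = 0, F 1 = 0 &
               forall x : 'I_n -> R, (forall i, x i \in `[0, 1]) ->
                 let xbar := n%:R^-1 * \sum_(i < n) x i in
                 F xbar `^ alpha <=
                   n%:R^-1 * \sum_(i < n)
                     (F (x i) `^ beta + `|x i - xbar| `^ beta)
                       `^ (alpha / beta)]].

(* Main.v *)
(* Write p = alpha / beta <= 1 and let f_m be the martingale of 1_A.  Since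
   (s, U) |-> (s + U^(1/p))^p is convex in U, the defining inequality of calB
   self-improves to
     (s + F(xbar)^beta)^p <= mean_i (s + |x_i - xbar|^beta + F(x_i)^beta)^p
   for every s >= 0.  Taking for s the variation accumulated along the n-adic
   tree, the integral of (sum_(m <= N) |d_m|^beta + F(f_N)^beta)^p is
   nondecreasing in N, and it equals F(|A|)^alpha at N = 0.  By subadditivity of
   t |-> t^p it is at most the integral of S^alpha plus that of F(f_N)^alpha,
   and the latter tends to 0 because f_N -> 1_A a.e. (Lebesgue differentiation)
   and F(0) = F(1) = 0. *)
Require Import Defs.
From mathcomp Require Import all_boot all_order all_algebra.
From mathcomp Require Import all_classical all_reals all_analysis.
From mathcomp Require Import measurable_realfun.
From mathcomp Require Import lra.

Set Implicit Arguments.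
Unset Strict Implicit.
Unset Printing Implicit Defensive.

Import Order.TTheory GRing.Theory Num.Theory.
Import numFieldNormedType.Exports.

Local Open Scope classical_set_scope.
Local Open Scope ring_scope.

(** * Power inequalities and the self-improvement of the defining inequality *)

(** The ratios r = a / (a + b) and r = b / (a + b) lie in [0, 1], where r <= r^p, and they add up to
    1. *)
Lemma powR_subadditive (R : realType) (p a b : R) :
  0 < p -> p <= 1 -> 0 <= a -> 0 <= b -> (a + b) `^ p <= a `^ p + b `^ p.
Proof.
move=> p0 p1 a0 b0.
have [t0|tN0] := eqVneq (a + b) 0.
  by rewrite t0 powR0 ?gt_eqF// addr_ge0// powR_ge0.
have t0 : 0 < a + b by rewrite lt_neqAle eq_sym tN0 addr_ge0.
have key x : 0 <= x -> x <= a + b ->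
    (a + b) `^ p * (x / (a + b)) <= x `^ p.
  rewrite le_eqVlt => /predU1P[<- _|x0 xt].
    by rewrite mul0r mulr0 powR_ge0.
  rewrite [leRHS](_ : _ = (a + b) `^ p * (x / (a + b)) `^ p); last first.
    by rewrite -powRM ?divr_ge0 ?ltW// mulrC divfK.
  rewrite ler_wpM2l ?powR_ge0// ger1_powR// divr_gt0//=.
  by rewrite ler_pdivrMr// mul1r.
rewrite (le_trans _ (lerD (key a a0 _) (key b b0 _))) ?lerDl ?lerDr//.
by rewrite -mulrDr -mulrDl divff// mulr1.
Qed.

Lemma powRVK (R : realType) (a r : R) :
  0 <= a -> r != 0 -> (a `^ r) `^ r^-1 = a.
Proof. by move=> a0 r0; rewrite -powRrM mulfV// powRr1. Qed.

(** Jensen's inequality for the convex function U |-> (s + U^(1/p))^p at the points u_i^p, whose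
    mean is U. It is derived from a two-term Hölder inequality for each i. *)
Lemma powR_shift_jensen (R : realType) (n : nat) (p s : R) (u : 'I_n -> R) :
  (0 < n)%N -> 0 < p -> p <= 1 -> 0 <= s -> (forall i, 0 <= u i) ->
  (s + (n%:R^-1 * \sum_(i < n) u i `^ p) `^ p^-1) `^ p <=
  n%:R^-1 * \sum_(i < n) (s + u i) `^ p.
Proof.
move=> n0 p0 p1 s0 u0.
have n0' : 0 < n%:R :> R by rewrite ltr0n.
have nV0 : 0 <= n%:R^-1 :> R by rewrite invr_ge0 ltW.
set U := n%:R^-1 * _.
have U0 : 0 <= U.
  by rewrite mulr_ge0// sumr_ge0// => i _; exact: powR_ge0.
have mean_cst (a : R) : n%:R^-1 * \sum_(i < n) a = a.
  by rewrite sumr_const card_ord -[a *+ n]mulr_natl mulrA mulVf ?mul1r ?gt_eqF.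
have [p1'|pN1] := eqVneq p 1.
  rewrite {}p1' in U U0 *.
  rewrite invr1 !powRr1 ?addr_ge0// (eq_bigr (fun i => s + u i)).
    rewrite big_split/= mulrDr mean_cst lerD2l /U.
    by rewrite (eq_bigr _ (fun i _ => powRr1 (u0 i))).
  by move=> i _; rewrite powRr1// addr_ge0.
have {p1 pN1} p1 : 0 < 1 - p by rewrite subr_gt0 lt_neqAle pN1.
set W := s + _.
have W0 : 0 <= W by rewrite addr_ge0// powR_ge0.
have [W00|WN0] := eqVneq W 0.
  rewrite W00 powR0 ?gt_eqF// mulr_ge0// sumr_ge0// => i _.
  exact: powR_ge0.
have Wgt0 : 0 < W by rewrite lt_neqAle eq_sym WN0.
have pV0 : 0 < p^-1 by rewrite invr_gt0.
(* Hölder with exponents 1/p and 1/(1 - p) for the pairs (s^p, u_i^p) and (s^(1-p), U^(1/p-1)). The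
   second pair is chosen independent of i, so that its norm is W^(1-p) for every i. *)
have key i : s + u i `^ p * U `^ (p^-1 - 1) <= (s + u i) `^ p * W `^ (1 - p).
  have := @hoelder2 R (s `^ p) (u i `^ p) (s `^ (1 - p)) (U `^ (p^-1 - 1))
    p^-1 (1 - p)^-1 (powR_ge0 _ _) (powR_ge0 _ _) (powR_ge0 _ _) (powR_ge0 _ _)
    pV0.
  rewrite invr_gt0 p1 !invrK addrC subrK => /(_ isT erefl).
  rewrite -powRD; last by rewrite addrC subrK oner_eq0.
  rewrite (powRVK s0 (lt0r_neq0 p0)) (powRVK (u0 i) (lt0r_neq0 p0)).
  rewrite (powRVK s0 (lt0r_neq0 p1)) -(powRrM U (p^-1 - 1) (1 - p)^-1).
  rewrite (addrC p) subrK.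
  rewrite (_ : (p^-1 - 1) / (1 - p) = p^-1); last first.
    have pN0 : p != 0 by rewrite gt_eqF.
    apply: (mulIf (lt0r_neq0 p1)).
    by rewrite divfK ?lt0r_neq0// mulrBr mulr1 mulVf.
  by rewrite !powRr1.
(* The mean over i of the left sides of [key] is s + U U^(1/p-1) = s + U^(1/p) = W. Dividing by
   W^(1-p) afterwards leaves W^p. *)
have : W <= (n%:R^-1 * \sum_(i < n) (s + u i) `^ p) * W `^ (1 - p).
  rewrite -mulrA mulr_suml.
  apply: le_trans
    (_ : n%:R^-1 * \sum_(i < n) (s + u i `^ p * U `^ (p^-1 - 1)) <= _).
    rewrite big_split/= mulrDr mean_cst -mulr_suml mulrA -/U.
    by rewrite mulr_powRB1.
  by rewrite ler_wpM2l// ler_sum.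
rewrite -{1}[W](powRr1 (ltW Wgt0)) -{1}(subrK p 1) addrC.
rewrite powRD ?ler_pM2r ?powR_gt0//.
by rewrite addrC subrK oner_eq0.
Qed.

(** Apply [powR_shift_jensen] with p = alpha / beta and u_i = F(x_i)^beta + |x_i - xbar|^beta. The
    inequality defining [calB], raised to the power 1/p, says that F(xbar)^beta is at most the
    (1/p)-th power of the mean of the u_i^p. *)
Lemma calB_shift (R : realType) (n : nat) (alpha beta s xbar : R) (F : R -> R)
    (x : 'I_n -> R) :
  (0 < n)%N -> 0 < alpha -> alpha <= 1 -> 1 <= beta -> calB alpha beta n F ->
  (forall i, x i \in `[0, 1]) -> xbar = n%:R^-1 * \sum_(i < n) x i -> 0 <= s ->
  (s + F xbar `^ beta) `^ (alpha / beta) <=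
  n%:R^-1 * \sum_(i < n)
    (s + `|x i - xbar| `^ beta + F (x i) `^ beta) `^ (alpha / beta).
Proof.
move=> n0 a0 a1 b1 [_ F0 _ _ FB] x01 xE s0.
have b0 : 0 < beta by rewrite (lt_le_trans _ b1).
have p0 : 0 < alpha / beta by rewrite divr_gt0.
have p1 : alpha / beta <= 1 by rewrite ler_pdivrMr// mul1r (le_trans a1).
pose u i := F (x i) `^ beta + `|x i - xbar| `^ beta.
have u0 i : 0 <= u i by rewrite addr_ge0// powR_ge0.
have := powR_shift_jensen n0 p0 p1 s0 u0.
under [in X in _ <= X -> _]eq_bigr do rewrite /u (addrC (F _ `^ _)) addrA.
move=> /(le_trans _); apply.
rewrite ge0_ler_powR ?nnegrE ?addr_ge0 ?powR_ge0 ?(ltW p0)//.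
rewrite lerD2l.
rewrite [F xbar `^ beta](_ : _ = (F xbar `^ alpha) `^ (alpha / beta)^-1).
  rewrite ge0_ler_powR ?nnegrE ?powR_ge0 ?invr_ge0 ?(ltW p0)//.
    by rewrite mulr_ge0 ?invr_ge0// sumr_ge0// => i _; rewrite powR_ge0.
  by have /= := FB x x01; rewrite -xE.
by rewrite -powRrM invf_div mulrC divfK// gt_eqF.
Qed.

(** * Induction along the n-adic tree *)

(** Node k of level N has parent k %/ n. The sum runs along the path from the root to that node; for
    martingale values c it is the beta-th power of the truncated S_beta. *)
Fixpoint tree_variation (R : realType) (n : nat) (beta : R)
    (c : nat -> nat -> R) (N k : nat) : R :=
  if N is N'.+1 then
    tree_variation n beta c N' (k %/ n) + `|c N k - c N' (k %/ n)%N| `^ beta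
  else 0.

Lemma tree_variation_ge0 (R : realType) n (beta : R) c N k :
  0 <= tree_variation n beta c N k.
Proof. by elim: N k => //= N IH k; rewrite addr_ge0// powR_ge0. Qed.

Lemma big_ord_mul (V : nmodType) (m n : nat) (g : nat -> V) :
  \sum_(j < m * n) g j = \sum_(k < m) \sum_(i < n) g (k * n + i)%N.
Proof.
rewrite -(big_mkord xpredT) big_nat_mul big_mkord; apply: eq_bigr => k _.
rewrite -{1}[(k * n)%N]add0n big_addn mulSn addnK big_mkord.
by apply: eq_bigr => i _; rewrite addnC.
Qed.

(** In the induction step [calB_shift] is applied at every node of level N, with s the variation
    accumulated there; s plus the new increment is the variation at the child. *)
Lemma calB_tree (R : realType) (n : nat) (alpha beta : R) (F : R -> R)
    (c : nat -> nat -> R) :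
  (0 < n)%N -> 0 < alpha -> alpha <= 1 -> 1 <= beta -> calB alpha beta n F ->
  (forall m k, (k < n ^ m)%N -> c m k \in `[0, 1]) ->
  (forall m k, (k < n ^ m)%N ->
     c m k = n%:R^-1 * \sum_(i < n) c m.+1 (k * n + i)%N) ->
  forall N, F (c 0 0) `^ alpha <= (n%:R ^+ N)^-1 *
    \sum_(k < n ^ N)
      (tree_variation n beta c N k + F (c N k) `^ beta) `^ (alpha / beta).
Proof.
move=> n0 a0 a1 b1 BF c01 cE; elim=> [|N IH].
  have b0 : beta != 0 by rewrite gt_eqF// (lt_le_trans _ b1).
  rewrite expr0 invr1 mul1r expn0 big_ord1 /= add0r -powRrM.
  by rewrite mulrC divfK.
apply: (le_trans IH); rewrite exprSr expnSr.
(* The nodes of level N+1 are grouped by parent: k * n + i is child i of node k. *)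
rewrite (big_ord_mul _ _ (fun k => (tree_variation n beta c N.+1 k +
  F (c N.+1 k) `^ beta) `^ (alpha / beta))) invfM -mulrA.
rewrite (mulrC n%:R^-1) mulrA -[leRHS]mulrA mulr_suml.
rewrite ler_wpM2l ?invr_ge0 ?exprn_ge0// ler_sum// => k _.
rewrite (mulrC _ n%:R^-1).
have kin (i : 'I_n) : (k * n + i < n ^ N.+1)%N.
  rewrite expnSr (leq_trans (n := k.+1 * n))//; last first.
    by rewrite leq_mul2r ltn_ord orbT.
  by rewrite mulSn addnC ltn_add2r.
have kdiv (i : 'I_n) : ((k * n + i) %/ n)%N = k.
  by rewrite divnMDl// divn_small// addn0.
have := @calB_shift R n alpha beta (tree_variation n beta c N k) (c N k) F
  (fun i : 'I_n => c N.+1 (k * n + i)%N) n0 a0 a1 b1 BF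
  (fun i => c01 _ _ (kin i))
  (cE _ _ (ltn_ord k)) (tree_variation_ge0 _ _ _ _ _).
by under [in X in _ -> _ <= X]eq_bigr do rewrite /= kdiv.
Qed.

(** * The n-adic intervals and their step functions *)

(** This has the shape of [adic_mean] with free coefficients, so that the martingale, its variation
    and F(f_m)^alpha are all treated alike. *)
Definition adic_step (R : realType) (n m : nat) (a : nat -> R) (x : R) : R :=
  \sum_(k < n ^ m) \1_(adic_itv n m k) x * a k.

Section adic.
Context {R : realType} {n : nat} (n0 : (0 < n)%N).
Implicit Types (m k : nat) (x : R) (a : nat -> R).

Lemma adic_itvE m k x :
  adic_itv n m k x <-> k%:R <= x * n%:R ^+ m < k.+1%:R.
Proof.
have nm0 : 0 < n%:R ^+ m :> R by rewrite exprn_gt0// ltr0n.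
by rewrite /adic_itv /= in_itv/= ler_pdivrMr// ltr_pdivlMr.
Qed.

Lemma adic_itv_index_inj m k j x :
  adic_itv n m k x -> adic_itv n m j x -> k = j.
Proof.
rewrite !adic_itvE => /andP[k1 k2] /andP[j1 j2].
have := le_lt_trans k1 j2; have := le_lt_trans j1 k2.
by rewrite !ltr_nat !ltnS => jk kj; apply/eqP; rewrite eqn_leq jk kj.
Qed.

Lemma adic_itv_parent m k x : adic_itv n m.+1 k x -> adic_itv n m (k %/ n) x.
Proof.
have n0' : 0 < n%:R :> R by rewrite ltr0n.
rewrite !adic_itvE exprSr mulrA => /andP[k1 k2]; apply/andP; split.
  rewrite -(ler_pM2r n0') (le_trans _ k1)// -natrM ler_nat.
  exact: leq_trunc_div.
rewrite -(ltr_pM2r n0') (lt_le_trans k2)// -natrM ler_nat.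
by rewrite ltn_ceil.
Qed.

Lemma adic_itv_child m k (i : 'I_n) x :
  adic_itv n m.+1 (k * n + i) x -> adic_itv n m k x.
Proof. by move=> /adic_itv_parent; rewrite divnMDl// divn_small// addn0. Qed.

Lemma adic_itv_cover m x : x \in `[0, 1[ ->
  exists2 k, (k < n ^ m)%N & adic_itv n m k x.
Proof.
have nm0 : 0 < n%:R ^+ m :> R by rewrite exprn_gt0// ltr0n.
rewrite in_itv/= => /andP[x0 x1].
have y0 : 0 <= x * n%:R ^+ m by rewrite mulr_ge0// ltW.
exists (Num.truncn (x * n%:R ^+ m)); last first.
  by apply/adic_itvE; exact: truncn_itv.
by rewrite truncn_lt_nat// natrX gtr_pMl.
Qed.

Lemma sub_adic_itv01 m k : (k < n ^ m)%N ->
  adic_itv n m k `<=` (`[0, 1[ : set R).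
Proof.
have nm0 : 0 < n%:R ^+ m :> R by rewrite exprn_gt0// ltr0n.
move=> km x /adic_itvE/andP[x1 x2]; rewrite /= in_itv/=; apply/andP; split.
  by rewrite -(pmulr_lge0 _ nm0) (le_trans _ x1).
rewrite -(ltr_pM2r nm0) mul1r (lt_le_trans x2)//.
by rewrite -natrX ler_nat.
Qed.

Lemma adic_stepE m a k x : (k < n ^ m)%N -> adic_itv n m k x ->
  adic_step n m a x = a k.
Proof.
move=> km kx; rewrite /adic_step (bigD1 (Ordinal km))//= indicE mem_set// mul1r.
rewrite big1 ?addr0// => i ik; rewrite indicE memNset ?mul0r// => ix.
by move/eqP: ik; apply; apply/val_inj => /=; exact: adic_itv_index_inj ix kx.
Qed.

End adic.

(** * Integrals of step functions, and Lebesgue measure against its completion *)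

Section step_integral.
Context d (T : measurableType d) {R : realType}.
Variables (mu : {measure set T -> \bar R}) (D : set T) (I : nat -> set T).
Hypotheses (mD : measurable D) (mI : forall k, measurable (I k)).

Lemma measurable_step (a : nat -> R) M :
  measurable_fun D (fun x => \sum_(k < M) \1_(I k) x * a k).
Proof.
by apply: measurable_sum => k; exact: measurable_funM.
Qed.

(** The measure is kept abstract because both Lebesgue measure on Borel sets and its completion are
    used. *)
Lemma integral_step (a : nat -> R) M :
  (forall k, 0 <= a k) ->
  (\int[mu]_(x in D) (\sum_(k < M) \1_(I k) x * a k)%:E =
   \sum_(k < M) (a k)%:E * mu (I k `&` D))%E.
Proof.
move=> a0; under eq_integral do rewrite -sumEFin.
rewrite ge0_integral_sum//; last 2 first.
- by move=> k; apply/measurable_EFinP/measurable_funM.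
- by move=> k x _; rewrite lee_fin mulr_ge0.
apply: eq_bigr => k _; under eq_integral do rewrite EFinM muleC.
by rewrite ge0_integralZl_EFin// ?integral_indic//; exact/measurable_EFinP.
Qed.

End step_integral.

Section adic_measure.
Context {R : realType} {n : nat} (n0 : (0 < n)%N).
Implicit Types (m k : nat) (x : R) (a : nat -> R).
Local Open Scope ereal_scope.

Lemma lebesgue_measure_adic_itv m k :
  lebesgue_measure (@adic_itv R n m k) = ((n%:R ^+ m)^-1)%:E.
Proof.
have nm0 : (0 < n%:R ^+ m :> R)%R by rewrite exprn_gt0// ltr0n.
rewrite /adic_itv lebesgue_measure_itv/= lte_fin ltr_pM2r ?invr_gt0//.
by rewrite ltr_nat ltnSn -EFinD -mulrBl -natr1 addrAC subrr add0r mul1r.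
Qed.

(** Both measures are the same set function, considered on different sigma-algebras, so this holds
    by conversion. *)
Lemma completed_lebesgue_measureE (A : set R) :
  completed_lebesgue_measure A = lebesgue_measure A.
Proof. by []. Qed.

Lemma borel_lebesgue_measurable (A : set R) :
  measurable A -> lebesgue_measurable A.
Proof. exact: sub_caratheodory. Qed.

(** The Carathéodory sigma-algebra is the completion of the Borel one, whose members are unions of a
    Borel set and a subset of a Borel null set. *)
Lemma lebesgue_measurable_borel (A : set R) : lebesgue_measurable A ->
  exists2 B : set R, measurable B &
   exists N : set R, [/\ measurable N, lebesgue_measure N = 0,
     B `<=` A & A `<=` B `|` N].
Proof.
rewrite /lebesgue_measurable -completed_caratheodory_measurable.
rewrite g_sigma_completed_algebra_genE => -[B mB [N [M [mM M0 NM]]] <-].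
exists B => //; exists M; split => //.
by move=> x [|/NM]; [left|right].
Qed.

Lemma integral_adic_step m a :
  (forall k, (0 <= a k)%R) ->
  \int[lebesgue_measure]_(x in `[0%R, 1%R[) (adic_step n m a x)%:E =
  ((n%:R ^+ m)^-1 * \sum_(k < n ^ m) a k)%:E.
Proof.
move=> a0; rewrite integral_step//; last by move=> k; exact: measurable_itv.
rewrite mulr_sumr -sumEFin; apply: eq_bigr => k _.
rewrite setIidl; last exact: sub_adic_itv01.
by rewrite /= lebesgue_measure_adic_itv -EFinM mulrC.
Qed.

Lemma completed_integral_adic_step m a :
  (forall k, (0 <= a k)%R) ->
  \int[completed_lebesgue_measure]_(x in `[0%R, 1%R[) (adic_step n m a x)%:E =
  ((n%:R ^+ m)^-1 * \sum_(k < n ^ m) a k)%:E.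
Proof.
move=> a0; rewrite integral_step//; last 2 first.
- by apply: borel_lebesgue_measurable; exact: measurable_itv.
- by move=> k; apply: borel_lebesgue_measurable; exact: measurable_itv.
rewrite mulr_sumr -sumEFin; apply: eq_bigr => k _.
rewrite setIidl; last exact: sub_adic_itv01.
rewrite /= completed_lebesgue_measureE.
by rewrite lebesgue_measure_adic_itv -EFinM mulrC.
Qed.

End adic_measure.

(** * Averages of the set over n-adic intervals *)

(* [lebesgue_measure] is an outer measure, so on the merely Lebesgue measurable
   set [A] it is the completed measure. *)
Definition adic_avg (R : realType) (n : nat) (A : set R) (m k : nat) : R :=
  n%:R ^+ m * fine (lebesgue_measure (A `&` adic_itv n m k)).

Section averages.
Context {R : realType} {n : nat} (n0 : (0 < n)%N).
Variable A : set R.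
Hypothesis mA : lebesgue_measurable A.
Implicit Types (m k : nat) (x : R).

Lemma lebesgue_measurable_adic_itv m k :
  lebesgue_measurable (@adic_itv R n m k).
Proof. by apply: borel_lebesgue_measurable; exact: measurable_itv. Qed.

Lemma measure_adic_itv_le m k :
  (completed_lebesgue_measure (A `&` adic_itv n m k) <=
   ((n%:R ^+ m)^-1)%:E)%E.
Proof.
rewrite -(lebesgue_measure_adic_itv n0 m k) -completed_lebesgue_measureE.
apply: le_measure; rewrite ?inE.
- by apply: measurableI => //; exact: lebesgue_measurable_adic_itv.
- exact: lebesgue_measurable_adic_itv.
- by move=> x [].
Qed.

Lemma measure_adic_itv_fin m k :
  completed_lebesgue_measure (A `&` adic_itv n m k) \is a fin_num.
Proof.
rewrite ge0_fin_numE ?measure_ge0//.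
exact: le_lt_trans (measure_adic_itv_le m k) (ltry _).
Qed.

Lemma adic_mean_indic m x :
  adic_mean n m (\1_A) x = adic_step n m (adic_avg n A m) x.
Proof.
apply: eq_bigr => k _; congr (_ * _); rewrite /adic_avg.
rewrite completed_lebesgue_measureE lebesgue_measure_adic_itv//= invrK.
congr (_ * _); rewrite /Rintegral integral_indic//.
exact: lebesgue_measurable_adic_itv.
Qed.

Lemma adic_avg_itv m k : adic_avg n A m k \in `[0, 1].
Proof.
have nm0 : 0 < n%:R ^+ m :> R by rewrite exprn_gt0// ltr0n.
rewrite in_itv/= /adic_avg mulr_ge0 ?(ltW nm0)//= -?completed_lebesgue_measureE.
  rewrite -ler_pdivlMl// mulr1.
  by rewrite -lee_fin fineK ?measure_adic_itv_fin// measure_adic_itv_le.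
by rewrite fine_ge0// measure_ge0.
Qed.

(** The factor 1 gives the right side the form that [integral_step] expects. *)
Lemma indic_adic_itv m k x : \1_(@adic_itv R n m k) x =
  \sum_(i < n) \1_(@adic_itv R n m.+1 (k * n + i)) x * 1 :> R.
Proof.
have n0' : 0 < n%:R :> R by rewrite ltr0n.
have [kx|kx] := pselect (adic_itv n m k x); last first.
  rewrite indicE memNset// big1// => i _.
  by rewrite indicE memNset ?mul0r// => /(adic_itv_child n0).
rewrite indicE mem_set//.
have /andP[k1 k2] := (adic_itvE n0 m k x).1 kx.
have x0 : 0 <= x * n%:R ^+ m by rewrite (le_trans _ k1).
have y0 : 0 <= x * n%:R ^+ m.+1 by rewrite exprSr mulrA mulr_ge0 ?(ltW n0').
(* The level m+1 interval containing x has index j; its parent contains x and is therefore k, so j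
   %% n selects the one nonzero term. *)
pose j := Num.truncn (x * n%:R ^+ m.+1).
have jx : adic_itv n m.+1 j x by apply/(adic_itvE n0); exact: truncn_itv.
have kj : (j %/ n)%N = k.
  exact: (adic_itv_index_inj n0 (adic_itv_parent n0 jx) kx).
have jE : j = (k * n + j %% n)%N by rewrite {1}(divn_eq j n) kj.
rewrite (bigD1 (Ordinal (ltn_pmod j n0)))//= -jE indicE mem_set// mulr1.
rewrite big1 ?addr0// => i ij; rewrite indicE memNset ?mul0r// => ix.
move/eqP: ij; apply; apply/val_inj => /=.
have := adic_itv_index_inj n0 ix jx.
by rewrite jE => /addnI ->; rewrite modnMDl modn_mod.
Qed.

Lemma adic_avg_mean m k :
  adic_avg n A m k = n%:R^-1 * \sum_(i < n) adic_avg n A m.+1 (k * n + i)%N.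
Proof.
have n0' : n%:R != 0 :> R by rewrite pnatr_eq0 -lt0n.
rewrite /adic_avg -mulr_sumr exprS mulrA mulKf//; congr (_ * _).
pose cmu := @completed_lebesgue_measure R.
have -> : lebesgue_measure (A `&` adic_itv n m k) =
    (\sum_(i < n) cmu (A `&` adic_itv n m.+1 (k * n + i)%N))%E.
  (* Additivity of the measure over the n children is obtained by integrating [indic_adic_itv] over
     A. *)
  transitivity (\int[cmu]_(x in A) (\1_(@adic_itv R n m k) x)%:E)%E.
    rewrite integral_indic//; first by rewrite setIC.
    exact: lebesgue_measurable_adic_itv.
  under eq_integral do rewrite indic_adic_itv.
  rewrite (@integral_step _ _ _ cmu A (fun i => adic_itv n m.+1 (k * n + i)%N)
    mA _ (fun=> 1) n)//.
  - by apply: eq_bigr => i _; rewrite mul1e setIC.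
  - by move=> i; exact: lebesgue_measurable_adic_itv.
rewrite -sum_fine// => i _; exact: measure_adic_itv_fin.
Qed.

Lemma adic_avg0 : A `<=` `[0, 1[ ->
  adic_avg n A 0 0 = fine (completed_lebesgue_measure A).
Proof.
move=> A01; rewrite /adic_avg expr0 mul1r; congr (fine (lebesgue_measure _)).
by rewrite /adic_itv expr0 !divr1 setIidl.
Qed.

End averages.

(** * Almost everywhere convergence of the averages and the vanishing remainder *)

(** A null set does not change averages; this carries Lebesgue differentiation from Borel sets to
    Lebesgue measurable ones. *)
Lemma adic_avg_borel {R : realType} {n : nat} (A : set R) :
  lebesgue_measurable A ->
  exists2 B : set R, measurable B & adic_avg n A = adic_avg n B.
Proof.
move=> mA; have [B mB [N [mN N0 BA ABN]]] := lebesgue_measurable_borel mA.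
exists B => //; apply/funext => m; apply/funext => k; rewrite /adic_avg.
congr (_ * fine _); set I := adic_itv n m k.
have mI : measurable I by exact: measurable_itv.
have mB' := borel_lebesgue_measurable mB.
have mN' := borel_lebesgue_measurable mN.
have mI' := borel_lebesgue_measurable mI.
apply/eqP; rewrite eq_le; apply/andP; split.
  rewrite -[leRHS]adde0 -N0 -!completed_lebesgue_measureE.
  rewrite (le_trans _ (measureU2 _ _ _))//; last exact: measurableI.
  apply: le_measure; rewrite ?inE.
  - exact: measurableI.
  - by apply: measurableU => //; exact: measurableI.
  - by move=> x [/ABN[Bx|Nx] Ix]; [left|right].
rewrite -!completed_lebesgue_measureE; apply: le_measure; rewrite ?inE.
- exact: measurableI.
- exact: measurableI.
- by move=> x [/BA].
Qed.

Lemma adic_avg_cvg {R : realType} {n : nat} (B : set R) :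
  (1 < n)%N -> measurable B ->
  {ae lebesgue_measure, forall x : R, x \in `[0, 1[ ->
    (adic_step n m (adic_avg n B m) x)%:E @[m --> \oo] --> (\1_B x)%:E}.
Proof.
move=> n1 mB; have n0 : (0 < n)%N by exact: ltnW.
have nm0 m : 0 < n%:R ^+ m :> R by rewrite exprn_gt0// ltr0n.
have nmV0 m : 0 < n%:R ^- m :> R by rewrite invr_gt0.
(* The floor gives the n-adic interval around any real x, so the family shrinks nicely at every
   point and not only in [0, 1). *)
pose z (x : R) m : R := (Num.floor (x * n%:R ^+ m))%:~R.
pose E (x : R) m : set R :=
  `[z x m / n%:R ^+ m, (z x m + 1) / n%:R ^+ m[%classic.
have muE x m : lebesgue_measure (E x m) = (n%:R ^- m)%:E.
  rewrite /E lebesgue_measure_itv/= lte_fin ltr_pM2r// ltrDl ltr01.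
  by rewrite -EFinD -mulrBl addrAC subrr add0r mul1r.
have nice x : nicely_shrinking x (E x).
  split; first by move=> m; exact: measurable_itv.
  (* The ball of radius n^-m around x contains the interval and has measure 2 n^-m, twice that of
     the interval. *)
  exists (2, fun m => PosNum (nmV0 m)); split => //=.
  - under eq_fun do rewrite -exprVn.
    apply: cvg_expr; rewrite ger0_norm ?invr_ge0 ?ler0n//.
    by rewrite invf_lt1 ?ltr0n// ltr1n.
  - move=> m y; rewrite /E /= in_itv/= ler_pdivrMr// ltr_pdivlMr//.
    move=> /andP[y1 y2].
    rewrite /ball/= -(ltr_pM2r (nm0 m)) mulVf ?gt_eqF//.
    rewrite -[X in _ * X](gtr0_norm (nm0 m)) -normrM mulrBl.
    have /andP[x1 x2] := Num.Theory.floor_itv (x * n%:R ^+ m).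
    move: x1 x2; rewrite intrD -/(z x m) => x1 x2.
    by rewrite ltr_norml; apply/andP; split; lra.
  - move=> m; rewrite muE lebesgue_measure_ball ?(ltW (nmV0 m))//.
    by rewrite -EFinM mulr_natl.
have loc := locally_integrable_indic openT mB.
have := lebesgue_differentiation loc.
apply: filter_app; first exact: (ae_filter_ringOfSetsType lebesgue_measure).
apply: aeW => /= x Lx x01.
apply: cvg_trans (nice_lebesgue_differentiation nice loc Lx).
apply: near_eq_cvg; near=> m.
have [k km kx] := adic_itv_cover n0 m x01.
have EE : E x m = adic_itv n m k.
  rewrite /E /adic_itv (_ : z x m = k%:R) ?natr1//.
  move/(adic_itvE n0): kx; rewrite /z => kx.
  by rewrite (@Num.Theory.floor_def _ _ k)// intrD; move: kx; rewrite -natr1.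
rewrite (adic_stepE n0 _ km kx) EE lebesgue_measure_adic_itv//.
rewrite integral_indic//=.
  rewrite inver gt_eqF// invrK /adic_avg EFinM fineK//.
  by apply: measure_adic_itv_fin => //; exact: borel_lebesgue_measurable.
exact: measurable_itv.
Unshelve. all: by end_near. Qed.

Lemma within_continuous_cvg_seq {R : realType} (F : R -> R) (D : set R)
    (u : nat -> R) (b : R) :
  {within D, continuous F} -> (forall m, D (u m)) -> D b ->
  u m @[m --> \oo] --> b -> F (u m) @[m --> \oo] --> F b.
Proof.
move=> /subspace_continuousP cF Du Db ub; apply: cvg_comp (cF b Db).
move=> P Pb; have uP : \forall m \near \oo, D (u m) -> P (u m) := ub _ Pb.
suff: \forall m \near \oo, P (u m) by [].
by apply: filterS uP => m; apply; exact: Du.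
Qed.

Lemma powR_cvg_seq0 {R : realType} (v : nat -> R) (a : R) : 0 < a ->
  (forall m, 0 <= v m) -> v m @[m --> \oo] --> 0 -> v m `^ a @[m --> \oo] --> 0.
Proof.
move=> a0 v0 /cvgrPdist_lt vc; apply/cvgrPdist_lt => e e0.
apply: filterS (vc (e `^ a^-1) (powR_gt0 _ e0)) => m.
rewrite !sub0r !normrN !ger0_norm ?powR_ge0// => ve.
rewrite -(@powRr1 _ e (ltW e0)) -(mulVf (lt0r_neq0 a0)) powRrM.
by rewrite gt0_ltr_powR ?nnegrE ?powR_ge0.
Qed.

(** The sequence is the integral of F(f_m)^alpha over [0, 1). Dominated convergence applies, with
    the constant (max F)^alpha as bound and limit 0 almost everywhere. *)
Lemma adic_avg_calB_cvg0 {R : realType} {n : nat} (alpha beta : R) (F : R -> R)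
    (A : set R) :
  (1 < n)%N -> 0 < alpha -> calB alpha beta n F -> lebesgue_measurable A ->
  (n%:R ^+ m)^-1 * (\sum_(k < n ^ m) F (adic_avg n A m k) `^ alpha)
    @[m --> \oo] --> 0.
Proof.
move=> n1 a0 [cF F0 F00 F10 _] mA; have n0 : (0 < n)%N by exact: ltnW.
have avg01 := adic_avg_itv n0 mA.
have [B mB AB] := @adic_avg_borel R n A mA.
pose f m (x : R) : \bar R :=
  (adic_step n m (fun k => F (adic_avg n A m k) `^ alpha) x)%:E.
have [c c01 Fc] := EVT_max (ler01 : (0 : R) <= 1) cF.
have Fc0 : 0 <= F c by exact: F0.
have D01 : measurable (`[0, 1[%classic : set R) by exact: measurable_itv.
have f0 : {ae (@lebesgue_measure R), forall x : R,
    (`[0, 1[%classic : set R) x -> f ^~ x @ \oo --> (0%E : \bar R)}.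
  have := adic_avg_cvg n1 mB.
  apply: filter_app; first exact: (ae_filter_ringOfSetsType lebesgue_measure).
  apply: aeW => /= x + x01 => /(_ x01) cx.
  pose u m := adic_step n m (adic_avg n A m) x.
  have uE m : u m \in `[0, 1] /\ f m x = (F (u m) `^ alpha)%:E.
    have [k km kx] := adic_itv_cover n0 m x01.
    by rewrite /u /f !(adic_stepE n0 _ km kx).
  have uB : u m @[m --> \oo] --> (\1_B x : R).
    by move: cx; rewrite -AB => /fine_cvg.
  (* The limit is the indicator of the Borel set B rather than of A; only its being 0 or 1 matters,
     as F(0) = F(1) = 0. *)
  have FB0 : F (\1_B x) = 0 by rewrite indicE; case: (x \in B).
  have -> : f ^~ x = (fun m => (F (u m) `^ alpha)%:E).
    by apply/funext => m; case: (uE m).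
  apply: cvg_EFin; first exact: nearW.
  apply: powR_cvg_seq0 => //; first by move=> m; apply: F0; case: (uE m).
  rewrite -FB0; apply: (within_continuous_cvg_seq cF) => //.
  - by move=> m; case: (uE m).
  - by rewrite /= in_itv/= indicE; case: (x \in B); rewrite ?ler01 ?lexx.
have fle : {ae (@lebesgue_measure R), forall (x : R) m,
    (`[0, 1[%classic : set R) x -> (`|f m x| <= cst (F c `^ alpha)%:E x)%E}.
  apply: aeW => /= x m x01; have [k km kx] := adic_itv_cover n0 m x01.
  rewrite /f (adic_stepE n0 _ km kx) ger0_norm ?powR_ge0// lee_fin.
  by rewrite ge0_ler_powR ?nnegrE ?(ltW a0)// ?Fc// F0.
have mf m : measurable_fun (`[0, 1[%classic : set R) (f m).
  by apply/measurable_EFinP; apply: measurable_step => k; exact: measurable_itv.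
have ig : lebesgue_measure.-integrable (`[0, 1[%classic : set R)
    (cst (F c `^ alpha)%:E).
  apply/integrableP; split; first exact: measurable_cst.
  rewrite integral_cst//= lebesgue_measure_itv/= lte01 oppr0 adde0 mule1.
  exact: ltry.
have [_ _] := @dominated_convergence _ _ R lebesgue_measure _ D01 f (cst 0%E) _
  mf (@measurable_cst _ _ _ _ _ 0%E) f0 ig fle.
rewrite integral0 => fc.
have -> : (fun m => (n%:R ^+ m)^-1 *
    \sum_(k < n ^ m) F (adic_avg n A m k) `^ alpha) =
    fine \o (fun m => \int[lebesgue_measure]_(x in `[0%R, 1%R[) f m x)%E.
  by apply/funext => m /=; rewrite integral_adic_step// => k; exact: powR_ge0.
exact: fine_cvg fc.
Qed.

(** * Comparison of the tree variation with S_beta *)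

(** The ancestors of the interval all contain x, so the increments along the path are the values
    d_m(x) for m = 1, ..., N. *)
Lemma tree_variationE {R : realType} {n : nat} (beta : R) (A : set R) N k x :
  (0 < n)%N -> lebesgue_measurable A ->
  (k < n ^ N)%N -> adic_itv n N k x ->
  tree_variation n beta (adic_avg n A) N k =
  \sum_(1 <= m < N.+1) `|adic_diff n m (\1_A) x| `^ beta.
Proof.
move=> n0 mA; elim: N k => [|N IH] k kN kx; first by rewrite big_geq.
have kN' : (k %/ n < n ^ N)%N by rewrite ltn_divLR// -expnSr.
have kx' := adic_itv_parent n0 kx.
rewrite /= (IH _ kN' kx') [RHS]big_nat_recr//=; congr (_ + `|_| `^ _).
rewrite /adic_diff /= !adic_mean_indic//.
by rewrite (adic_stepE n0 _ kN kx) (adic_stepE n0 _ kN' kx').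
Qed.

Lemma tree_variation_le_S_fun {R : realType} {n : nat} (alpha beta : R)
    (A : set R) N k x :
  (0 < n)%N -> 0 < alpha -> 0 < beta -> lebesgue_measurable A ->
  (k < n ^ N)%N -> adic_itv n N k x ->
  ((tree_variation n beta (adic_avg n A) N k `^ (alpha / beta))%:E <=
   S_fun n beta (\1_A) x `^ alpha)%E.
Proof.
move=> n0 a0 b0 mA kN kx.
have d0 m : (0 <= (`|adic_diff n m (\1_A) x| `^ beta)%:E)%E.
  by rewrite lee_fin powR_ge0.
(* The outer powers 1/beta and alpha merge into alpha / beta, leaving a partial sum to be compared
   with its series. *)
rewrite /S_fun -poweRrM mulrC -poweR_EFin.
rewrite (tree_variationE beta n0 mA kN kx) -sumEFin.
apply: gt0_ler_poweR.
- by rewrite mulr_ge0 ?invr_ge0 ?(ltW a0) ?(ltW b0).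
- by rewrite in_itv/= leey sume_ge0.
- by rewrite in_itv/= leey nneseries_ge0.
- by apply: nneseries_lim_ge => m _ _.
Qed.

(** Measurability is meant for the completed sigma-algebra, as monotonicity of the completed
    integral requires; the conditional expectations are step functions. *)
Lemma measurable_S_fun {R : realType} {n : nat} (beta : R) (A : set R) :
  (0 < n)%N -> lebesgue_measurable A ->
  measurable_fun
    (setT : set (caratheodory_type ((wlength (@idfun R))^*)%mu))
    (S_fun n beta (\1_A)).
Proof.
move=> n0 mA.
have mmean m : measurable_fun
    (setT : set (caratheodory_type ((wlength (@idfun R))^*)%mu))
    (adic_mean n m (\1_A : R -> R)).
  rewrite (_ : adic_mean n m (\1_A) = adic_step n m (adic_avg n A m)).
    exact: (@measurable_step _ (caratheodory_type ((wlength (@idfun R))^*)%mu)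
      R setT _ (lebesgue_measurable_adic_itv m) (adic_avg n A m) (n ^ m)%N).
  by apply/funext => x; rewrite adic_mean_indic.
apply: (measurableT_comp (measurable_poweR _)).
under eq_fun do rewrite ereal_series.
apply: ge0_emeasurable_sum => [m x _ _|m _]; first by rewrite lee_fin powR_ge0.
apply/measurable_EFinP/(measurableT_comp (measurable_powR _)).
apply: (measurableT_comp (@normr_measurable R setT)).
exact: measurable_funB.
Qed.

Lemma tree_variation_integral_le {R : realType} {n : nat} (alpha beta : R)
    (A : set R) N :
  (0 < n)%N -> 0 < alpha -> 0 < beta -> lebesgue_measurable A ->
  (((n%:R ^+ N)^-1 * \sum_(k < n ^ N)
      tree_variation n beta (adic_avg n A) N k `^ (alpha / beta))%:E <=
   \int[completed_lebesgue_measure]_(x in `[0%R, 1%R[)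
     (S_fun n beta (\1_A) x `^ alpha))%E.
Proof.
move=> n0 a0 b0 mA.
pose X k := tree_variation n beta (adic_avg n A) N k `^ (alpha / beta).
rewrite -(@completed_integral_adic_step R n n0 N X); last first.
  by move=> k; exact: powR_ge0.
apply: ge0_le_integral.
- by apply: borel_lebesgue_measurable; exact: measurable_itv.
- move=> x x01; have [k kN kx] := adic_itv_cover n0 N x01.
  by rewrite (adic_stepE n0 _ kN kx) lee_fin powR_ge0.
- apply/measurable_EFinP; apply: (@measurable_step _
    (caratheodory_type ((wlength (@idfun R))^*)%mu) R _ _
    (lebesgue_measurable_adic_itv N) X (n ^ N)%N).
- apply: (measurableT_comp (measurable_poweR _)).
  apply: measurable_funTS; exact: measurable_S_fun.
- move=> x x01; have [k kN kx] := adic_itv_cover n0 N x01.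
  by rewrite (adic_stepE n0 _ kN kx); exact: tree_variation_le_S_fun.
Qed.

(** * Passage to the limit in the tree inequality *)

Theorem theorem2p2 (R : realType) (n : nat) (alpha beta : R) (F : R -> R)
    (A : set R) :
  (2 <= n)%N -> 0 < alpha -> alpha <= 1 -> 1 <= beta ->
  calB alpha beta n F ->
  lebesgue_measurable A -> A `<=` `[0, 1[ ->
  ((F (fine (completed_lebesgue_measure A)))%:E
     <= norm01 alpha (S_fun n beta (\1_A)))%E.
Proof.
move=> n1 a0 a1 b1 BF mA A01.
have n0 : (0 < n)%N by exact: ltnW.
have b0 : 0 < beta by rewrite (lt_le_trans _ b1).
have p0 : 0 < alpha / beta by rewrite divr_gt0.
have p1 : alpha / beta <= 1 by rewrite ler_pdivrMr// mul1r (le_trans a1).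
have avg01 := adic_avg_itv n0 mA.
have F0 : forall x, x \in `[0, 1] -> 0 <= F x by case: BF.
have F00 : 0 <= F (adic_avg n A 0 0) by apply: F0; exact: avg01.
rewrite /norm01; set L := (\int[_]_(_ in _) _)%E.
rewrite -(@adic_avg0 R n A A01).
have L0 : (0 <= L)%E by apply: integral_ge0 => x _; exact: poweR_ge0.
(* The root average is |A|, and taking the power 1/alpha of both sides gives the claim. *)
suff FL : ((F (adic_avg n A 0 0) `^ alpha)%:E <= L)%E.
  rewrite -[F _](powRVK F00 (lt0r_neq0 a0)) -poweR_EFin.
  apply: gt0_ler_poweR => //.
  - by rewrite invr_ge0 ltW.
  - by rewrite in_itv/= leey lee_fin powR_ge0.
  - by rewrite in_itv/= leey L0.
apply/lee_addgt0Pr => e e0.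
(* The level N is chosen so that the integral of F(f_N)^alpha is below e. *)
have /cvgrPdist_lt/(_ e e0) [N _ /(_ N (leqnn N))] :=
  adic_avg_calB_cvg0 n1 a0 BF mA.
rewrite /= sub0r normrN => /(le_lt_trans (ler_norm _)) /ltW FN.
have := calB_tree n0 a0 a1 b1 BF (fun m k _ => avg01 m k)
  (fun m k _ => adic_avg_mean n0 mA m k) N.
set V := tree_variation n beta _ N => FV.
have {}FV : F (adic_avg n A 0 0) `^ alpha <=
    (n%:R ^+ N)^-1 * (\sum_(k < n ^ N) V k `^ (alpha / beta)) +
    (n%:R ^+ N)^-1 * (\sum_(k < n ^ N) F (adic_avg n A N k) `^ alpha).
  apply: (le_trans FV); rewrite -mulrDr -big_split/=.
  rewrite ler_wpM2l ?invr_ge0 ?exprn_ge0// ler_sum// => k _.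
  (* Subadditivity of t |-> t^(alpha/beta) separates the variation from F(f_N)^beta, whose power is
     F(f_N)^alpha. *)
  rewrite (le_trans (powR_subadditive p0 p1 _ _)) ?powR_ge0//.
    exact: tree_variation_ge0.
  by rewrite -powRrM mulrCA mulfV ?mulr1// lt0r_neq0.
apply: le_trans (_ : ((n%:R ^+ N)^-1 *
    (\sum_(k < n ^ N) V k `^ (alpha / beta)) + e)%:E <= _)%E.
  by rewrite lee_fin (le_trans FV)// lerD2l.
by rewrite EFinD leeD2r// tree_variation_integral_le.
Qed.
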